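(* Let $(M,L,\tilde L)$ be a flat bi-Lagrangian manifold of dimension $2m$. There exists a bijective correspondence between the fields $(g,B)$ on $M$ and the generalized metrics $\mathcal H$ on $M$ that have a non-degenerate restriction to the bundle $L^*$.
   Context: Flat bi-Lagrangian (flat para-Kähler) manifold: a $2m$-dimensional manifold $M$ with an atlas of distinguished local coordinates $(x^i,\tilde x_i)$, $i=1,\dots,m$, whose coordinate changes are locally $x^i=\alpha^i_jx'^j+\alpha^i_0$, $\tilde x_i=\beta_i^k\tilde x'_k+\beta_i^0$ with constants satisfying $\alpha^i_j\beta_i^k=\delta_j^k$. $L$ and $\tilde L$ are the subbundles of $TM$ spanned by the $\partial/\partial x^i$ and by the $\partial/\partial\tilde x_i$, respectively, so $TM=L\oplus\tilde L$. $\gamma$ is the neutral metric on $M$ with $L,\tilde L$ isotropic and $\gamma(\partial/\partial x^i,\partial/\partial\tilde x_j)=\delta_i^j$. The dual $L^*$ is identified with the annihilator $\mathrm{ann}\,\tilde L\subset T^*M$, and $L\oplus L^*$ is identified with $TM$ by $(X,\alpha)\mapsto X+\sharp_\gamma\alpha$ (so $L^*$ corresponds to $\tilde L$); then $\gamma((X,\alpha),(Y,\beta))=\beta(X)+\alpha(Y)$. A field is a pair $(g,B)$, where $g$ is a non-degenerate metric on the bundle $L$ with positive/negative inertia indices $p,q$, $p+q=m$, and $B\in\Gamma\wedge^2L^*$ is a $2$-form on $L$. A generalized metric is a (pseudo-Riemannian) metric $\mathcal H$ on $TM$ that is compatible with $\gamma$ in the sense that it further reduces the structure group of $TM$ from $O(m,m)$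 to $O(p,q)\times O(q,p)$, i.e. there is a decomposition $TM=S_+\oplus S_-$ into rank $m$ subbundles, orthogonal for both $\gamma$ and $\mathcal H$, with $\mathcal H|_{S_+}=\gamma|_{S_+}$ of inertia indices $(p,q)$ and $\mathcal H|_{S_-}=-\gamma|_{S_-}$, where $\gamma|_{S_-}$ has inertia indices $(q,p)$. *)

(* Defs.v *)
From HB Require Import structures.
From mathcomp Require Import all_boot all_order all_algebra.
From mathcomp Require Import all_classical all_reals all_analysis.

Set Implicit Arguments.
Unset Strict Implicit.
Unset Printing Implicit Defensive.

Import Order.TTheory GRing.Theory Num.Theory.
Import numFieldNormedType.Exports.

Local Open Scope classical_set_scope.
Local Open Scope ring_scope.

Section Calculus.
Context {R : realType} {V : normedModType R}.

Fixpoint is_Ck (k : nat) (U : set V) (f : V -> R) : Prop :=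
  if k is k'.+1 then
    (forall u, U u -> differentiable f u) /\
    (forall v, is_Ck k' U (fun u => 'D_v f u))
  else forall u, U u -> {for u, continuous f}.

(* Meaningful for open U only. *)
Definition is_smooth (U : set V) (f : V -> R) := forall k, is_Ck k U f.

End Calculus.

Section LinearAlgebra.
Context {R : realType}.

Definition bil n (G : 'M[R]_n) (v w : 'cV[R]_n) : R := (v^T *m G *m w) ord0 ord0.

Definition is_basis n k (F : 'M[R]_(n, k)) (S : set 'cV[R]_n) :=
  \rank F = k /\ S = range (fun a : 'cV[R]_k => F *m a).

Definition nondegenerate_on n (G : 'M[R]_n) (S : set 'cV[R]_n) :=
  forall v, S v -> (forall w, S w -> bil G v w = 0) -> v = 0.

(* The restriction of G to the subspace S is non-degenerate with p positive
   and q negative squares: S has a pseudo-orthonormal basis of that type. *)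
Definition inertia_on n (G : 'M[R]_n) (S : set 'cV[R]_n) (p q : nat) :=
  exists2 F : 'M[R]_(n, p + q), is_basis F S &
    F^T *m G *m F = block_mx 1%:M 0 0 (- 1%:M).

End LinearAlgebra.

(* A chart c has domain [dom c] and coordinates [coord c y], the column
   (x^1, .., x^m, xt_1, .., xt_m).  [coord_open], with continuity and
   injectivity, says that [coord c] is a homeomorphism of [dom c] onto an open
   subset of R^(2m).  In [coord_change], the linear part of the change of
   coordinates is constant near each point, not on the whole overlap, and
   [a^T *m b = 1%:M] reads alpha^i_j beta_i^k = delta_j^k. *)
Record bilagrangian (R : realType) (m : nat) (M : topologicalType) :=
  Bilagrangian {
    chart : Type;
    dom : chart -> set M;
    coord : chart -> M -> 'cV[R]_(m + m);
    bl_hausdorff : hausdorff_space M;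
    bl_second_countable : @second_countable M;
    dom_open : forall c, open (dom c);
    dom_cover : forall x, exists c, dom c x;
    coord_continuous : forall c x, dom c x -> {for x, continuous (coord c)};
    coord_inj : forall c, set_inj (dom c) (coord c);
    coord_open : forall c (V : set M),
      open V -> V `<=` dom c -> open (coord c @` V);
    coord_change : forall c c' x, dom c x -> dom c' x ->
      exists (a b : 'M[R]_m) (a0 b0 : 'cV[R]_m),
        a^T *m b = 1%:M /\
        \forall y \near x,
          usubmx (coord c y) = a *m usubmx (coord c' y) + a0 /\
          dsubmx (coord c y) = b *m dsubmx (coord c' y) + b0
  }.

Section BiLagrangian.
Context {R : realType} {m : nat} {M : topologicalType} (A : bilagrangian R m M).

(* a = d x / d x' and b = d xt / d xt' at the point x. *)
Definition jacobian_at (c c' : chart A) (x : M) (a b : 'M[R]_m) :=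
  a^T *m b = 1%:M /\
  exists a0 b0 : 'cV[R]_m, \forall y \near x,
    usubmx (coord c y) = a *m usubmx (coord c' y) + a0 /\
    dsubmx (coord c y) = b *m dsubmx (coord c' y) + b0.

Definition smooth_in_chart (c : chart A) (V : set M) (f : M -> R) :=
  exists2 f' : 'cV[R]_(m + m) -> R, is_smooth (coord c @` V) f' &
    forall y, V y -> f y = f' (coord c y).

(* Tensor fields are given by their components in all distinguished charts:
   [T c x] is the matrix of a bilinear form on T_x M (n = m + m), in the frame
   (d/dx^1, .., d/dx^m, d/dxt_1, .., d/dxt_m), or on L_x (n = m), in the frame
   (d/dx^1, .., d/dx^m).  Outside [dom c] the components have no meaning; they
   are required to vanish there, so that equality of tensor fields is equality
   of component families. *)
Definition components (n : nat) := chart A -> M -> 'M[R]_n.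

Definition smooth_components n (T : components n) :=
  forall c, (forall i j, smooth_in_chart c (dom c) (fun x => T c x i j)) /\
            (forall x, ~ dom c x -> T c x = 0).

Definition form_on_L (T : components m) :=
  smooth_components T /\
  forall c c' x a b, dom c x -> dom c' x -> jacobian_at c c' x a b ->
    T c' x = a^T *m T c x *m a.

Definition form_on_TM (T : components (m + m)) :=
  smooth_components T /\
  forall c c' x a b, dom c x -> dom c' x -> jacobian_at c c' x a b ->
    T c' x = (block_mx a 0 0 b)^T *m T c x *m block_mx a 0 0 b.

(* [S c x] is the fibre at x, as a set of vectors of components in the chart c.
   The last clause asks for smooth local frames. *)
Definition subbundle (k : nat) (S : chart A -> M -> set 'cV[R]_(m + m)) :=
  (forall c c' x a b, dom c x -> dom c' x -> jacobian_at c c' x a b ->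
     S c x = (fun v => block_mx a 0 0 b *m v) @` S c' x) /\
  (forall c x, dom c x ->
     exists (V : set M) (F : M -> 'M[R]_(m + m, k)),
       [/\ open V, V x, V `<=` dom c,
           forall i j, smooth_in_chart c V (fun y => F y i j) &
           forall y, V y -> is_basis (F y) (S c y)]).

(* gamma has the same components in every distinguished chart; so do the
   fibres of Ltilde and of L*. *)
Definition gamma : 'M[R]_(m + m) := block_mx 0 1%:M 1%:M 0.

Definition Ltilde : set 'cV[R]_(m + m) :=
  range (fun v : 'cV[R]_m => col_mx 0 v).

Definition ann (S : set 'cV[R]_(m + m)) : set 'rV[R]_(m + m) :=
  [set alpha | forall v, S v -> alpha *m v = 0].

(* L* = ann Ltilde, carried into TM by the isomorphism sharp_gamma. *)
Definition Lstar : set 'cV[R]_(m + m) :=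
  [set v | exists2 alpha, ann Ltilde alpha &
     forall w, bil gamma v w = (alpha *m w) ord0 ord0].

Definition is_field (p q : nat) (gB : components m * components m) :=
  [/\ form_on_L gB.1, form_on_L gB.2 &
   forall c x, dom c x ->
     [/\ (gB.1 c x)^T = gB.1 c x, inertia_on (gB.1 c x) setT p q &
         (gB.2 c x)^T = - gB.2 c x]].

Definition metric_on_TM (H : components (m + m)) :=
  form_on_TM H /\
  forall c x, dom c x -> (H c x)^T = H c x /\ nondegenerate_on (H c x) setT.

Definition generalized_metric (p q : nat) (H : components (m + m)) :=
  metric_on_TM H /\
  exists Sp Sm : chart A -> M -> set 'cV[R]_(m + m),
    [/\ subbundle m Sp, subbundle m Sm &
     forall c x, dom c x ->
       (forall v, exists! uw : 'cV[R]_(m + m) * 'cV[R]_(m + m),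
          [/\ Sp c x uw.1, Sm c x uw.2 & v = uw.1 + uw.2]) /\
       (forall v w, Sp c x v -> Sm c x w ->
          bil gamma v w = 0 /\ bil (H c x) v w = 0) /\
       (forall v w, Sp c x v -> Sp c x w ->
          bil (H c x) v w = bil gamma v w) /\
       (forall v w, Sm c x v -> Sm c x w ->
          bil (H c x) v w = - bil gamma v w) /\
       inertia_on gamma (Sp c x) p q /\
       inertia_on gamma (Sm c x) q p].

Definition nondegenerate_on_Lstar (H : components (m + m)) :=
  forall c x, dom c x -> nondegenerate_on (H c x) Lstar.

End BiLagrangian.

(* Main.v *)
Require Import Defs.
From mathcomp Require Import all_boot all_order all_algebra.
From mathcomp Require Import all_classical all_reals all_analysis.

(** Why the correspondence holds.  In a distinguished chart a metric on TM is a
symmetric matrix H of size 2m, and gamma swaps the L and L* components of a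
vector (X, xi).  If TM = S+ + S- is orthogonal for gamma and H, with H = gamma
on S+ and H = - gamma on S-, then gamma^-1 H is an involution with eigenbundles
S+ and S-; equivalently H gamma H = gamma ([compatible_involution]).  So S+ and
S- are determined by H, and everything is linear algebra at a point.

From fields to metrics.  Given (g, B), take for S+ and S- the graphs of B + g
and B - g : L -> L*.  Writing a vector as (X, B X + g Y), the graphs are Y = X
and Y = - X, and the metric sought is the one for which gamma^-1 H exchanges X
and Y ([gen_metric_col]).  Solving for H gives the block matrix
  g - B g^-1 B    B g^-1
  - g^-1 B        g^-1
called [gen_metric g B].  On the two graphs gamma induces 2 g and - 2 g
([graph_gamma]), which yields the inertia indices (p, q) and (q, p).  The block
on L* is g^-1, so the restriction to L* is non-degenerate.

From metrics to fields.  Non-degeneracy on L* means that the block D of H on L*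
is invertible, hence g must be D^-1 and, if C is the block to the left of D, B
must be - D^-1 C.  The block equations contained in H gamma H = gamma say
exactly that this B is antisymmetric ([form_part_antisym]) and that (g, B) gives
back H ([gen_metricK]).  The relation H = gamma on S+ puts S+ inside the graph
of B + g, so a pseudo-orthonormal basis of S+ projects to one of 2 g
([inertia_metric_part]).

Both constructions are natural for the coordinate changes diag(a, b) with
a^T b = 1 ([gen_metric_congr], [metric_part_congr], [form_part_congr]), and
their entries are rational functions, without poles, of the given components;
hence they preserve tensoriality and smoothness.  The latter rests on the
stability of [is_Ck] under sums, products and inverses. *)

Set Implicit Arguments.
Unset Strict Implicit.
Unset Printing Implicit Defensive.

Import Order.TTheory GRing.Theory Num.Theory.
Import numFieldNormedType.Exports.

Local Open Scope classical_set_scope.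
Local Open Scope ring_scope.

(** * Functions of class C^k *)

Section SmoothFunctions.
Context {R : realType} {V : normedModType R}.
Implicit Types (f g : V -> R) (U : set V).

(** Base case for the locality of differentiability: the zero map is a valid
differential, and differentials are unique. *)
Lemma differentiable_near0 f u :
  (\forall y \near u, f y = 0) -> differentiable f u.
Proof.
move=> f0; have fu0 : f u = 0 by exact: nbhs_singleton f0.
have exp0 : f \o shift u = cst (f u) + (\0 : V -> R) +o_ 0 id.
  apply/eqaddoP => _/posnumP[e]; rewrite fu0 /=.
  have : \forall h \near (0 : V), f (h + u) = 0.
    by move: f0; rewrite (near_shift 0 u) subr0.
  apply: filterS => h fh0; rewrite !fctE /= fh0 ?addr0 ?subrr ?normr0.
  by rewrite mulr_ge0.
apply/diff_locallyP.
have -> : 'd f u = (\0 : {linear V -> R}) :> (V -> R).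
  by apply: diff_unique exp0 => y; exact: cst_continuous.
by split => // y; exact: cst_continuous.
Qed.

Lemma near_eq_differentiable f g u :
  {near u, f =1 g} -> differentiable f u -> differentiable g u.
Proof.
move=> fg df; have -> : g = f + (g - f) by rewrite addrC subrK.
apply: differentiableD => //; apply: differentiable_near0.
by apply: filterS fg => y fgy; rewrite !fctE fgy subrr.
Qed.

(** [is_Ck] mentions the values of a function only on [U], but differentiates it
as a function on the whole space; the Leibniz rules below hold on [U] only, so
their iteration needs the independence of [is_Ck] from values outside the open
set [U]. *)
Lemma eq_is_Ck k U f g : open U -> (forall u, U u -> f u = g u) ->
  is_Ck k U f -> is_Ck k U g.
Proof.
elim: k f g => [|k IH] f g oU fg /=.
  move=> cf u Uu; have cfu : f @ u --> f u := cf u Uu.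
  change (g @ u --> g u); rewrite -(fg u Uu).
  apply: cvg_trans cfu; apply: near_eq_cvg.
  by apply: filterS (open_nbhs_nbhs (conj oU Uu)) => y /fg ->.
have nfg u : U u -> {near u, f =1 g}.
  by move=> Uu; apply: filterS (open_nbhs_nbhs (conj oU Uu)) => y /fg.
move=> [df Df]; split=> [u Uu|v].
  exact: near_eq_differentiable (nfg u Uu) (df u Uu).
by apply: IH (Df v) => // u Uu; exact/near_eq_derive/nfg.
Qed.

Lemma is_CkW k U f : is_Ck k.+1 U f -> is_Ck k U f.
Proof.
elim: k f => [|k IH] f; first by move=> [df _] u /df /differentiable_continuous.
by move=> [df Df]; split=> // v; exact/IH/Df.
Qed.

Lemma is_Ck_cst k U (r : R) : is_Ck k U (cst r).
Proof.
elim: k r => [|k IH] r /=; first by move=> u _; exact: cst_continuous.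
split=> [u _|v]; first exact: differentiable_cst.
rewrite (_ : (fun u => _) = cst 0) //.
by apply/funext => u; rewrite derive_cst.
Qed.

Lemma is_CkD k U f g : open U -> is_Ck k U f -> is_Ck k U g ->
  is_Ck k U (f + g).
Proof.
move=> oU; elim: k f g => [|k IH] f g /=.
  by move=> cf cg u Uu; exact: continuousD (cf u Uu) (cg u Uu).
move=> [df Df] [dg Dg]; split=> [u Uu|v].
  exact: differentiableD (df u Uu) (dg u Uu).
apply: eq_is_Ck (IH _ _ (Df v) (Dg v)) => // u Uu.
by rewrite deriveD //; apply: diff_derivable; [exact: df|exact: dg].
Qed.

Lemma is_CkM k U f g : open U -> is_Ck k U f -> is_Ck k U g ->
  is_Ck k U (f * g).
Proof.
move=> oU; elim: k f g => [|k IH] f g.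
  by move=> cf cg u Uu; exact: continuousM (cf u Uu) (cg u Uu).
move=> Cf Cg; have [df Df] := Cf; have [dg Dg] := Cg; split=> [u Uu|v].
  exact: differentiableM (df u Uu) (dg u Uu).
have := is_CkD oU (IH _ _ (is_CkW Cf) (Dg v)) (IH _ _ (is_CkW Cg) (Df v)).
apply: eq_is_Ck => // u Uu.
by rewrite deriveM //; apply: diff_derivable; [exact: df|exact: dg].
Qed.

(** The derivative of 1/f is - (1/f)^2 f', to which the
induction hypothesis and the stability under products apply at one order less. *)
Lemma is_CkV k U f : open U -> (forall u, U u -> f u != 0) -> is_Ck k U f ->
  is_Ck k U (fun u => (f u)^-1).
Proof.
move=> oU f0; elim: k => [|k IH].
  by move=> cf u Uu; exact: continuousV (f0 u Uu) (cf u Uu).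
move=> Cf; have [df Df] := Cf; split=> [u Uu|v].
  exact: differentiableV (df u Uu) (f0 u Uu).
have Ci := IH (is_CkW Cf).
have := is_CkM oU (is_CkM oU (is_Ck_cst k U (-1)) (is_CkM oU Ci Ci)) (Df v).
apply: eq_is_Ck => // u Uu.
rewrite deriveV ?f0//; last exact/diff_derivable/df.
by rewrite !fctE mulN1r expr2 invfM.
Qed.

End SmoothFunctions.

(** * Smooth matrix-valued functions in a chart *)

Section SmoothMatrices.
Context {R : realType} {m : nat} {M : topologicalType}
  {A : bilagrangian R m M} {c : chart A} {V : set M}.
Hypotheses (oV : open V) (Vc : V `<=` dom c).
Implicit Types f g : M -> R.

Lemma open_coord_image : open (Defs.coord c @` V).
Proof. exact: coord_open. Qed.
#[local] Hint Resolve open_coord_image : core.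

Lemma eq_smooth_in_chart f g : (forall y, V y -> f y = g y) ->
  smooth_in_chart c V f -> smooth_in_chart c V g.
Proof. by move=> fg [f' sf ff']; exists f' => // y Vy; rewrite -fg ?ff'. Qed.

Lemma smooth_in_chart_cst (r : R) : smooth_in_chart c V (fun=> r).
Proof. by exists (cst r) => // k; exact: is_Ck_cst. Qed.

Lemma smooth_in_chartD f g : smooth_in_chart c V f -> smooth_in_chart c V g ->
  smooth_in_chart c V (fun y => f y + g y).
Proof.
move=> [f' sf ff'] [g' sg gg']; exists (f' + g').
  by move=> k; exact: is_CkD (sf k) (sg k).
by move=> y Vy; rewrite ff' ?gg'.
Qed.

Lemma smooth_in_chartM f g : smooth_in_chart c V f -> smooth_in_chart c V g ->
  smooth_in_chart c V (fun y => f y * g y).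
Proof.
move=> [f' sf ff'] [g' sg gg']; exists (f' * g').
  by move=> k; exact: is_CkM (sf k) (sg k).
by move=> y Vy; rewrite ff' ?gg'.
Qed.

Lemma smooth_in_chartV f : (forall y, V y -> f y != 0) ->
  smooth_in_chart c V f -> smooth_in_chart c V (fun y => (f y)^-1).
Proof.
move=> f0 [f' sf ff']; exists (fun u => (f' u)^-1).
  by move=> k; apply: is_CkV (sf k) => // _ [y Vy <-]; rewrite -ff' ?f0.
by move=> y Vy; rewrite ff'.
Qed.

Lemma smooth_in_chart_sum (I : finType) (F : I -> M -> R) :
  (forall i, smooth_in_chart c V (F i)) ->
  smooth_in_chart c V (fun y => \sum_i F i y).
Proof.
move=> sF; elim: (index_enum I) => [|i s IH].
  apply: eq_smooth_in_chart (smooth_in_chart_cst 0) => y _.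
  by rewrite big_nil.
apply: eq_smooth_in_chart (smooth_in_chartD (sF i) IH) => y _.
by rewrite big_cons.
Qed.

Lemma smooth_in_chart_prod (I : finType) (F : I -> M -> R) :
  (forall i, smooth_in_chart c V (F i)) ->
  smooth_in_chart c V (fun y => \prod_i F i y).
Proof.
move=> sF; elim: (index_enum I) => [|i s IH].
  apply: eq_smooth_in_chart (smooth_in_chart_cst 1) => y _.
  by rewrite big_nil.
apply: eq_smooth_in_chart (smooth_in_chartM (sF i) IH) => y _.
by rewrite big_cons.
Qed.

Definition smooth_mx n k (F : M -> 'M[R]_(n, k)) :=
  forall i j, smooth_in_chart c V (fun y => F y i j).

Lemma smooth_mx_cst n k (X : 'M[R]_(n, k)) : smooth_mx (fun=> X).
Proof. by move=> i j; exact: smooth_in_chart_cst. Qed.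

Lemma smooth_mxD n k (F G : M -> 'M[R]_(n, k)) :
  smooth_mx F -> smooth_mx G -> smooth_mx (fun y => F y + G y).
Proof.
move=> sF sG i j.
apply: eq_smooth_in_chart (smooth_in_chartD (sF i j) (sG i j)) => y _.
by rewrite mxE.
Qed.

Lemma smooth_mxM n k l (F : M -> 'M[R]_(n, k)) (G : M -> 'M[R]_(k, l)) :
  smooth_mx F -> smooth_mx G -> smooth_mx (fun y => F y *m G y).
Proof.
move=> sF sG i j.
have := smooth_in_chart_sum (fun h => smooth_in_chartM (sF i h) (sG h j)).
by apply: eq_smooth_in_chart => y _; rewrite mxE.
Qed.

Lemma smooth_mxN n k (F : M -> 'M[R]_(n, k)) :
  smooth_mx F -> smooth_mx (fun y => - F y).
Proof.
move=> sF i j.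
apply: eq_smooth_in_chart (smooth_in_chartM (smooth_in_chart_cst (-1)) (sF i j)).
by move=> y _; rewrite mxE mulN1r.
Qed.

Lemma smooth_col_mx n1 n2 k (F : M -> 'M[R]_(n1, k)) (G : M -> 'M[R]_(n2, k)) :
  smooth_mx F -> smooth_mx G -> smooth_mx (fun y => col_mx (F y) (G y)).
Proof.
move=> sF sG i j; rewrite -(splitK i); case: (fintype.split i) => i' /=.
  by apply: eq_smooth_in_chart (sF i' j) => y _; rewrite col_mxEu.
by apply: eq_smooth_in_chart (sG i' j) => y _; rewrite col_mxEd.
Qed.

Lemma smooth_block_mx n1 n2 k1 k2 (F11 : M -> 'M[R]_(n1, k1))
    (F12 : M -> 'M[R]_(n1, k2)) (F21 : M -> 'M[R]_(n2, k1))
    (F22 : M -> 'M[R]_(n2, k2)) :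
  smooth_mx F11 -> smooth_mx F12 -> smooth_mx F21 -> smooth_mx F22 ->
  smooth_mx (fun y => block_mx (F11 y) (F12 y) (F21 y) (F22 y)).
Proof.
move=> s11 s12 s21 s22; apply: smooth_col_mx => i j.
  rewrite -(splitK j); case: (fintype.split j) => j' /=.
    by apply: eq_smooth_in_chart (s11 i j') => y _; rewrite row_mxEl.
  by apply: eq_smooth_in_chart (s12 i j') => y _; rewrite row_mxEr.
rewrite -(splitK j); case: (fintype.split j) => j' /=.
  by apply: eq_smooth_in_chart (s21 i j') => y _; rewrite row_mxEl.
by apply: eq_smooth_in_chart (s22 i j') => y _; rewrite row_mxEr.
Qed.

Lemma smooth_det n (F : M -> 'M[R]_n) :
  smooth_mx F -> smooth_in_chart c V (fun y => \det (F y)).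
Proof.
move=> sF; apply: smooth_in_chart_sum => s; apply: smooth_in_chartM.
  exact: smooth_in_chart_cst.
by apply: smooth_in_chart_prod => i; exact: sF.
Qed.

(** Cramer's rule: inverses are adjugates divided by determinants, and both of
these are polynomials in the entries. *)
Lemma smooth_invmx n (F : M -> 'M[R]_n) : (forall y, V y -> F y \in unitmx) ->
  smooth_mx F -> smooth_mx (fun y => invmx (F y)).
Proof.
move=> uF sF i j.
have sdet : smooth_in_chart c V (fun y => (\det (F y))^-1).
  apply: smooth_in_chartV (smooth_det sF) => y /uF.
  by rewrite unitmxE unitfE.
have sadj : smooth_in_chart c V (fun y => \adj (F y) i j).
  have smin : smooth_mx (fun y => row' j (col' i (F y))).
    move=> k l; apply: eq_smooth_in_chart (sF (lift j k) (lift i l)) => y _.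
    by rewrite !mxE.
  have := smooth_in_chart_cst ((-1) ^+ (j + i)).
  move=> /smooth_in_chartM /(_ (smooth_det smin)).
  by apply: eq_smooth_in_chart => y _; rewrite mxE.
apply: eq_smooth_in_chart (smooth_in_chartM sdet sadj) => y Vy.
by rewrite /invmx uF // [RHS]mxE.
Qed.

End SmoothMatrices.

(** * Bilinear forms and inertia *)

Section PointwiseAlgebra.
Context {R : realType}.

Lemma trmxZ n k (r : R) (F : 'M[R]_(n, k)) : (r *: F)^T = r *: F^T.
Proof. exact: linearZ. Qed.

Lemma row_eq0P n (u : 'rV[R]_n) :
  (forall w : 'cV[R]_n, (u *m w) ord0 ord0 = 0) -> u = 0.
Proof.
move=> u0; apply/rowP => j; rewrite mxE -(u0 (delta_mx j ord0)).
by rewrite -colE mxE.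
Qed.

Lemma eq_bil n (G G' : 'M[R]_n) (v : 'cV[R]_n) : G^T = G -> G'^T = G' ->
  (forall w, bil G v w = bil G' v w) -> G *m v = G' *m v.
Proof.
move=> sG sG' e; apply: trmx_inj; rewrite !trmx_mul sG sG'.
apply/subr0_eq/row_eq0P => w; rewrite mulmxBl.
have := e w; rewrite /bil => e'.
by rewrite [LHS]mxE e' [X in _ + X]mxE subrr.
Qed.

Lemma bilDr n (G : 'M[R]_n) (u v w : 'cV[R]_n) :
  bil G u (v + w) = bil G u v + bil G u w.
Proof. by rewrite /bil mulmxDr mxE. Qed.

Lemma bilN n (G : 'M[R]_n) (v w : 'cV[R]_n) : bil (- G) v w = - bil G v w.
Proof. by rewrite /bil mulmxN mulNmx mxE. Qed.

Lemma bil_sym n (G : 'M[R]_n) (v w : 'cV[R]_n) : G^T = G ->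
  bil G v w = bil G w v.
Proof.
move=> sG; rewrite /bil.
transitivity ((v^T *m G *m w)^T ord0 ord0); first by rewrite [RHS]mxE.
by rewrite !trmx_mul trmxK sG mulmxA.
Qed.

Lemma bil_mulmx n k l (G : 'M[R]_n) (F : 'M[R]_(n, k)) (F' : 'M[R]_(n, l)) a b :
  bil G (F *m a) (F' *m b) = (a^T *m (F^T *m G *m F') *m b) ord0 ord0.
Proof. by rewrite /bil trmx_mul !mulmxA. Qed.

(** A vector of S pairs with T to zero under both forms, so what it pairs to is
already seen on S. *)
Lemma bil_eq_on_summand n (G G' : 'M[R]_n) (S T : set 'cV[R]_n) :
  G^T = G -> G'^T = G' ->
  (forall v, exists u w, [/\ S u, T w & v = u + w]) ->
  (forall v w, S v -> T w -> bil G v w = 0 /\ bil G' v w = 0) ->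
  (forall v w, S v -> S w -> bil G v w = bil G' v w) ->
  forall u, S u -> G *m u = G' *m u.
Proof.
move=> sG sG' dec orth eqS u Su; apply: eq_bil => // v.
have [s [t [Ss Tt ->]]] := dec v.
by have [uGt uG't] := orth u t Su Tt; rewrite !bilDr uGt uG't eqS.
Qed.

Definition signature p q : 'M[R]_(p + q) := block_mx 1%:M 0 0 (- 1%:M).

Lemma signatureK p q : signature p q *m signature p q = 1%:M.
Proof.
rewrite mulmx_block !mulmx0 !mul0mx mulmx1 addr0 add0r !addr0 mulmxN mulmx1.
by rewrite opprK add0r -scalar_mx_block.
Qed.

(** On the whole space the basis condition is automatic: the signature matrix is
invertible, hence so is F. *)
Lemma inertia_setTP n p q (G : 'M[R]_n) : (p + q)%N = n ->
  inertia_on G setT p q <->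
  exists F : 'M[R]_(n, p + q), F^T *m G *m F = signature p q.
Proof.
move=> hn; split=> [[F _ FG]|[F FG]]; first by exists F.
exists F => //; subst n.
have /mulmx1_unit[_] : signature p q *m F^T *m G *m F = 1%:M.
  by rewrite -!mulmxA (mulmxA F^T) FG signatureK.
move=> uF; split; first exact: mxrank_unit.
apply/esym/seteqP; split=> // v _; exists (invmx F *m v) => //.
by rewrite mulKVmx.
Qed.

Lemma inertia_unit n p q (G : 'M[R]_n) : (p + q)%N = n ->
  inertia_on G setT p q -> G \in unitmx.
Proof.
move=> hn /(inertia_setTP _ hn)[F FG]; subst n.
have : F^T *m G *m F \in unitmx.
  by rewrite FG; have [] := mulmx1_unit (signatureK p q).
by rewrite !unitmx_mul => /andP[/andP[]].
Qed.

Lemma inertia_scale n p q (r : R) (G : 'M[R]_n) : (p + q)%N = n -> 0 < r ->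
  inertia_on G setT p q -> inertia_on (r *: G) setT p q.
Proof.
move=> hn r0 /(inertia_setTP _ hn)[F FG]; apply/(inertia_setTP _ hn).
exists ((Num.sqrt r)^-1 *: F).
rewrite trmxZ -!(scalemxAl, scalemxAr) FG !scalerA.
have s0 : Num.sqrt r != 0 by rewrite sqrtr_eq0 -ltNge.
have er : r = Num.sqrt r * Num.sqrt r by rewrite -expr2 sqr_sqrtr // ltW.
move: s0 er; move: (Num.sqrt r) => s s0 ->.
by rewrite mulKf // mulVf // scale1r.
Qed.

(** Changing the sign exchanges the two blocks of a pseudo-orthonormal basis. *)
Lemma inertia_opp n p q (G : 'M[R]_n) : (p + q)%N = n ->
  inertia_on G setT p q -> inertia_on (- G) setT q p.
Proof.
move=> hn /(inertia_setTP _ hn)[F].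
rewrite -(hsubmxK F) tr_row_mx mul_col_mx mul_col_row.
move=> /eq_block_mx[e11 e12 e21 e22].
apply/inertia_setTP; first by rewrite addnC.
exists (row_mx (rsubmx F) (lsubmx F)).
rewrite tr_row_mx mul_col_mx mul_col_row !mulmxN !mulNmx e11 e12 e21 e22.
by rewrite !oppr0 opprK.
Qed.

(** The inverse of a singular matrix is that matrix by convention; so components
built from vanishing ones vanish, also outside the domain of a chart. *)
Lemma invmx0 n : invmx (0 : 'M[R]_n) = 0.
Proof.
have [u0|u0] := boolP ((0 : 'M[R]_n) \in unitmx); last by rewrite invmx_out.
by rewrite -[LHS]mul1mx -(mulmxV u0) !mul0mx.
Qed.

Lemma mulmx_tr_dual n (a b : 'M[R]_n) : a^T *m b = 1%:M -> a *m b^T = 1%:M.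
Proof. by move=> ab; apply: trmx_inj; rewrite trmx_mul trmxK trmx1 mulmx1C. Qed.

Lemma invmx_congr n (a b g : 'M[R]_n) : a^T *m b = 1%:M -> g \in unitmx ->
  invmx (a^T *m g *m a) = b^T *m invmx g *m b.
Proof.
move=> ab ug.
have ba : b^T *m a = 1%:M by apply: trmx_inj; rewrite trmx_mul trmxK ab trmx1.
have e : b^T *m invmx g *m b *m (a^T *m g *m a) = 1%:M.
  rewrite !mulmxA -(mulmxA _ b) (mulmx1C ab) mulmx1.
  by rewrite -(mulmxA _ _ g) mulVmx // mulmx1.
have [_ u] := mulmx1_unit e.
by rewrite -[RHS](mulmxK u) e mul1mx.
Qed.

(** * The metric of a pair (g, B) at a point *)

Section Block.
Context {m : nat}.
Implicit Types (g B K a b : 'M[R]_m) (H : 'M[R]_(m + m)).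

(** The metric H for which gamma^-1 H exchanges X and Y in (X, B X + g Y). *)
Definition gen_metric g B : 'M[R]_(m + m) :=
  block_mx (g - B *m invmx g *m B) (B *m invmx g)
           (- (invmx g *m B))      (invmx g).

Lemma gen_metric0 : gen_metric 0 0 = 0.
Proof. by rewrite /gen_metric invmx0 !mulmx0 subr0 oppr0 block_mx0. Qed.

Lemma gamma_sym : (gamma : 'M[R]_(m + m))^T = gamma.
Proof. by rewrite tr_block_mx !trmx0 !trmx1. Qed.

Lemma gamma_col k (X Y : 'M[R]_(m, k)) : gamma *m col_mx X Y = col_mx Y X.
Proof. by rewrite mul_block_col !mul0mx !mul1mx add0r addr0. Qed.

(** The defining property of [gen_metric g B], from which its restrictions to
the two graphs and its non-degeneracy follow. *)
Lemma gen_metric_col k g B (X Y : 'M[R]_(m, k)) : g \in unitmx ->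
  gen_metric g B *m col_mx X (B *m X + g *m Y) = col_mx (B *m Y + g *m X) Y.
Proof.
move=> ug; rewrite mul_block_col !mulmxDr mulmxBl mulNmx !mulmxA.
rewrite -(mulmxA B _ g) mulVmx // mulmx1 mul1mx; congr col_mx.
  by rewrite addrA subrK addrC.
by rewrite addrA addNr add0r.
Qed.

Lemma gen_metric_sym g B : g^T = g -> B^T = - B ->
  (gen_metric g B)^T = gen_metric g B.
Proof.
move=> sg sB; rewrite tr_block_mx; congr block_mx.
- by rewrite linearB /= !trmx_mul trmx_inv sg sB !(mulNmx, mulmxN) opprK mulmxA.
- by rewrite linearN /= trmx_mul trmx_inv sg sB mulNmx opprK.
- by rewrite trmx_mul trmx_inv sg sB mulmxN.
- by rewrite trmx_inv sg.
Qed.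

(** The cotangent components transform by b, the inverse transpose of a, so each
of the four blocks is a product in which the inner factors a b^T and b a^T
cancel. *)
Lemma gen_metric_congr g B a b : a^T *m b = 1%:M -> g \in unitmx ->
  gen_metric (a^T *m g *m a) (a^T *m B *m a) =
  (block_mx a 0 0 b)^T *m gen_metric g B *m block_mx a 0 0 b.
Proof.
move=> ab ug.
have ba := mulmx_tr_dual ab.
rewrite /gen_metric (invmx_congr ab ug) tr_block_mx !trmx0 !mulmx_block.
rewrite !mulmx0 !mul0mx !addr0 !add0r; congr block_mx.
- rewrite mulmxBr mulmxBl; congr (_ - _); rewrite !mulmxA.
  by rewrite -(mulmxA _ a b^T) ba mulmx1 -(mulmxA _ b a^T) (mulmx1C ab) mulmx1.
- by rewrite !mulmxA -(mulmxA _ a b^T) ba mulmx1.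
- rewrite mulmxN mulNmx; congr (- _); rewrite !mulmxA.
  by rewrite -(mulmxA _ b a^T) (mulmx1C ab) mulmx1.
Qed.

(** The lower blocks g^-1 and - g^-1 B already determine the pair. *)
Lemma gen_metric_inj g g' B B' : g \in unitmx ->
  gen_metric g B = gen_metric g' B' -> g = g' /\ B = B'.
Proof.
move=> ug /eq_block_mx[_ _ eC eD].
have eg : g = g' by rewrite -(invmxK g) eD invmxK.
split=> //; subst g'.
by rewrite -(mulKVmx ug B) -[LHS]opprK -mulmxN eC mulmxN opprK mulKVmx.
Qed.

Lemma gen_metric_nondegenerate g B : g^T = g -> B^T = - B -> g \in unitmx ->
  nondegenerate_on (gen_metric g B) setT.
Proof.
move=> sg sB ug v _ v0.
have : gen_metric g B *m v = 0.
  rewrite -(mul0mx _ v); apply: eq_bil; rewrite ?gen_metric_sym ?trmx0 // => w.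
  by rewrite v0 // /bil mulmx0 mul0mx mxE.
rewrite -(vsubmxK v); set X := usubmx v; set xi := dsubmx v.
have -> : xi = B *m X + g *m (invmx g *m (xi - B *m X)).
  by rewrite mulKVmx // addrC subrK.
rewrite gen_metric_col // => /eqP; rewrite col_mx_eq0 => /andP[/eqP e /eqP Y0].
move: e; rewrite Y0 !mulmx0 add0r addr0 => gX.
by rewrite -(mulKmx ug X) gX !mulmx0 col_mx0.
Qed.

Definition graph_frame K : 'M[R]_(m + m, m) := col_mx 1%:M K.

Definition graph K : set 'cV[R]_(m + m) :=
  range (fun X : 'cV_m => graph_frame K *m X).

Lemma graph_frameM k K (X : 'M[R]_(m, k)) :
  graph_frame K *m X = col_mx X (K *m X).
Proof. by rewrite mul_col_mx mul1mx. Qed.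

Lemma mxrank_graph_frame k K (X : 'M[R]_(m, k)) :
  \rank (graph_frame K *m X) = \rank X.
Proof.
apply/eqP; rewrite eqn_leq mxrankM_maxr /=.
have eX : X = row_mx 1%:M 0 *m (graph_frame K *m X).
  by rewrite graph_frameM mul_row_col mul1mx mul0mx addr0.
by rewrite {1}eX mxrankM_maxr.
Qed.

Lemma graph_basis K : is_basis (graph_frame K) (graph K).
Proof.
by split=> //; rewrite -(mulmx1 (graph_frame K)) mxrank_graph_frame mxrank1.
Qed.

(** The metric gamma sees only the symmetric part of K on its graph; with K and
K' equal to B + g and B - g this gives the orthogonality of the two graphs. *)
Lemma graph_gamma K K' :
  (graph_frame K)^T *m gamma *m graph_frame K' = K^T + K'.
Proof.
by rewrite -mulmxA gamma_col tr_col_mx mul_row_col trmx1 mul1mx mulmx1 addrC.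
Qed.

Lemma graph_congr K a b : a^T *m b = 1%:M ->
  graph K = (fun v => block_mx a 0 0 b *m v) @` graph (a^T *m K *m a).
Proof.
move=> ab.
have e (X : 'cV[R]_m) : block_mx a 0 0 b *m (graph_frame (a^T *m K *m a) *m X) =
    graph_frame K *m (a *m X).
  rewrite !graph_frameM mul_block_col !mul0mx addr0 add0r !mulmxA.
  by rewrite (mulmx1C ab) mul1mx.
have ba := mulmx_tr_dual ab.
apply/seteqP; split=> [_ [X _ <-]|_ [_ [X _ <-] <-]].
  exists (graph_frame (a^T *m K *m a) *m (b^T *m X)); first by exists (b^T *m X).
  by rewrite e (mulmxA a) ba mul1mx.
by exists (a *m X); rewrite ?e.
Qed.

Lemma inertia_graph p q K :
  inertia_on (K^T + K) setT p q -> inertia_on gamma (graph K) p q.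
Proof.
move=> [F [rF sF] FK]; exists (graph_frame K *m F); last first.
  by rewrite trmx_mul !mulmxA -(mulmxA F^T) -(mulmxA F^T) graph_gamma.
split; first by rewrite mxrank_graph_frame.
apply/seteqP; split=> [_ [X _ <-]|_ [Y _ <-]].
  have [Y _ <-] : range (fun Y => F *m Y) X by rewrite -sF.
  by exists Y; rewrite ?mulmxA.
by exists (F *m Y); rewrite ?mulmxA.
Qed.

(** In the coordinates (X, B X + g Y) this is the splitting of (X, Y) into its
symmetric and antisymmetric parts (X + Y) / 2 and (X - Y) / 2. *)
Lemma gen_metric_decomposition g B (v : 'cV[R]_(m + m)) : g \in unitmx ->
  exists! uw : 'cV[R]_(m + m) * 'cV[R]_(m + m),
    [/\ graph (B + g) uw.1, graph (B - g) uw.2 & v = uw.1 + uw.2].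
Proof.
move=> ug.
pose Y := invmx g *m (dsubmx v - B *m usubmx v).
pose h : R := 2^-1.
have hZ (Z : 'cV[R]_m) : h *: (Z + Z) = Z.
  by rewrite -mulr2n -scaler_nat scalerA mulVf ?scale1r // pnatr_eq0.
pose X1 := h *: (usubmx v + Y); pose X2 := h *: (usubmx v - Y).
have eX : X1 + X2 = usubmx v.
  by rewrite -scalerDr addrACA subrr addr0 hZ.
have eY : X1 - X2 = Y.
  by rewrite -scalerBr opprD opprK addrACA subrr add0r hZ.
exists (graph_frame (B + g) *m X1, graph_frame (B - g) *m X2).
split=> [|[_ _] [/= [Z1 _ <-] [Z2 _ <-] ev]].
  split; [by exists X1|by exists X2|rewrite /= !graph_frameM add_col_mx eX].
  rewrite mulmxDl mulmxBl addrACA -mulmxDr -mulmxBr eX eY mulKVmx //.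
  by rewrite addrC subrK vsubmxK.
rewrite !graph_frameM add_col_mx mulmxDl mulmxBl addrACA -mulmxDr -mulmxBr in ev.
have eZ : Z1 + Z2 = usubmx v by rewrite ev col_mxKu.
have eZ' : Z1 - Z2 = Y.
  by rewrite /Y -eZ ev col_mxKd [_ + _ - _]addrC addKr mulKmx.
have e1 (Z Z' : 'cV[R]_m) : Z = h *: ((Z + Z') + (Z - Z')).
  by rewrite addrACA subrr addr0 hZ.
have -> : Z1 = X1 by rewrite (e1 Z1 Z2) eZ eZ'.
have -> : Z2 = X2.
  by apply: (addrI Z1); rewrite eZ {1}(e1 Z1 Z2) eZ eZ' eX.
by [].
Qed.

Lemma gen_metric_graph g B : g \in unitmx ->
  gen_metric g B *m graph_frame (B + g) = gamma *m graph_frame (B + g) /\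
  gen_metric g B *m graph_frame (B - g) = - (gamma *m graph_frame (B - g)).
Proof.
move=> ug; have := gen_metric_col B 1%:M _ ug; rewrite mulmx1 => e.
split; rewrite gamma_col.
  by have := e 1%:M; rewrite !mulmx1.
by have := e (- 1%:M); rewrite !mulmxN !mulmx1 opp_col_mx opprB [- B + _]addrC.
Qed.

(** The one-form gamma(v, -) has components (xi, X) if v = (X, xi), and it
annihilates Ltilde exactly when X = 0. *)
Lemma LstarP (v : 'cV[R]_(m + m)) : Lstar v <-> usubmx v = 0.
Proof.
split=> [[alpha annalpha ev]|v0].
  have ea : v^T *m gamma = alpha.
    apply/subr0_eq/row_eq0P => w; rewrite mulmxBl.
    have := ev w; rewrite /bil => e'.
    by rewrite [LHS]mxE e' [X in _ + X]mxE subrr.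
  apply: trmx_inj; rewrite trmx0; apply: row_eq0P => w.
  have <- : alpha *m col_mx 0 w = (usubmx v)^T *m w.
    rewrite -ea -mulmxA gamma_col -{1}(vsubmxK v) tr_col_mx mul_row_col.
    by rewrite mulmx0 addr0.
  by rewrite annalpha ?mxE //; exists w.
exists (v^T *m gamma) => [_ [w _ <-]|w //].
rewrite -mulmxA gamma_col -(vsubmxK v) v0 tr_col_mx mul_row_col.
by rewrite mulmx0 trmx0 mul0mx addr0.
Qed.

Lemma bil_Lstar H (xi eta : 'cV[R]_m) :
  bil H (col_mx 0 xi) (col_mx 0 eta) = (xi^T *m drsubmx H *m eta) ord0 ord0.
Proof.
rewrite /bil -{1}(submxK H) -mulmxA mul_block_col !mulmx0 !add0r.
by rewrite tr_col_mx mul_row_col trmx0 mul0mx add0r mulmxA.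
Qed.

Lemma nondegenerate_on_LstarP H :
  nondegenerate_on H Lstar <-> drsubmx H \in unitmx.
Proof.
split=> [nd|uD v Lv v0].
  rewrite -row_free_unit -kermx_eq0; apply/eqP/row_matrixP => i.
  rewrite row0; apply: trmx_inj; rewrite trmx0.
  set xi := (row i _)^T.
  have /eqP : col_mx 0 xi = 0 :> 'cV[R]_(m + m).
    apply: nd => [|w]; first by apply/LstarP; rewrite col_mxKu.
    move=> /LstarP w0; rewrite -(vsubmxK w) w0 bil_Lstar trmxK -row_mul mulmx_ker.
    by rewrite row0 mul0mx mxE.
  by rewrite col_mx_eq0 => /andP[_ /eqP].
have /LstarP u0 := Lv.
rewrite -(vsubmxK v) u0.
suff -> : dsubmx v = 0 by rewrite col_mx0.
apply: trmx_inj; rewrite trmx0 -(mulmxK uD (dsubmx v)^T).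
suff -> : (dsubmx v)^T *m drsubmx H = 0 by rewrite mul0mx.
apply: row_eq0P => w; rewrite -bil_Lstar -u0 vsubmxK u0.
by apply: v0; apply/LstarP; rewrite col_mxKu.
Qed.

(** * The pair (g, B) of a metric at a point *)

(** [metric_part] and [form_part] solve D = g^-1 and C = - g^-1 B, where C and D
are the lower blocks of H; see [gen_metric]. *)
Definition metric_part H : 'M[R]_m := invmx (drsubmx H).
Definition form_part H : 'M[R]_m := - (invmx (drsubmx H) *m dlsubmx H).

Lemma metric_part0 : metric_part 0 = 0.
Proof.
rewrite /metric_part (_ : drsubmx 0 = 0) ?invmx0 //.
by apply/matrixP => i j; rewrite !mxE.
Qed.

Lemma form_part0 : form_part 0 = 0.
Proof. by rewrite /form_part -/(metric_part 0) metric_part0 mul0mx oppr0. Qed.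

Section Reconstruction.
Variable H : 'M[R]_(m + m).
Hypotheses (sH : H^T = H) (uD : drsubmx H \in unitmx).

Lemma metric_part_sym : (metric_part H)^T = metric_part H.
Proof. by rewrite trmx_inv trmx_drsub sH. Qed.

Hypothesis HH : H *m gamma *m H = gamma.

Let ur_block : ursubmx H = (dlsubmx H)^T.
Proof. by rewrite trmx_dlsub sH. Qed.

Let gamma_blocks :
  drsubmx H *m ulsubmx H + dlsubmx H *m dlsubmx H = 1%:M /\
  drsubmx H *m (dlsubmx H)^T + dlsubmx H *m drsubmx H = 0.
Proof.
move: HH; rewrite -{1 2}(submxK H) !mulmx_block !mulmx0 !mulmx1 !addr0 !add0r.
by rewrite -ur_block => /eq_block_mx[_ _ -> ->].
Qed.

(** The lower right block of H gamma H = gamma reads D C^T + C D = 0; multiplied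
by D^-1 on both sides it becomes the antisymmetry of D^-1 C. *)
Lemma form_part_antisym : (form_part H)^T = - form_part H.
Proof.
have [_ /eqP] := gamma_blocks; rewrite addr_eq0 => /eqP e.
rewrite /form_part linearN /= trmx_mul metric_part_sym opprK.
rewrite -[(dlsubmx H)^T](mulKmx uD) e mulmxN mulNmx opprK.
by rewrite !mulmxA mulmxK.
Qed.

(** The block equation D E + C C = 1 gives the remaining upper left block E. *)
Lemma gen_metricK : gen_metric (metric_part H) (form_part H) = H.
Proof.
have [e1 e2] := gamma_blocks.
have eB : form_part H *m drsubmx H = (dlsubmx H)^T.
  rewrite -[RHS](mulKmx uD) /form_part mulNmx -mulmxA -mulmxN; congr (_ *m _).
  by apply/esym/eqP; rewrite -addr_eq0 e2.
rewrite /gen_metric /metric_part invmxK eB -[RHS]submxK ur_block.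
congr block_mx; last by rewrite /form_part mulmxN opprK mulKVmx.
rewrite -[RHS](mulKmx uD) -[X in X - _ = _]mulmx1 -e1 mulmxDr /form_part.
rewrite mulmxN opprK.
by rewrite (mulmxA _^T) -eB mulmxK // mulNmx (mulmxA _ (dlsubmx H)) addrK.
Qed.

End Reconstruction.

Lemma metric_part_congr H a b : a^T *m b = 1%:M -> drsubmx H \in unitmx ->
  metric_part ((block_mx a 0 0 b)^T *m H *m block_mx a 0 0 b) =
  a^T *m metric_part H *m a.
Proof.
move=> ab uD; rewrite /metric_part -{1}(submxK H) tr_block_mx !trmx0.
rewrite !mulmx_block !mulmx0 !mul0mx !addr0 !add0r block_mxKdr.
rewrite (@invmx_congr _ b a) //.
by apply: trmx_inj; rewrite trmx_mul trmxK ab trmx1.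
Qed.

Lemma form_part_congr H a b : a^T *m b = 1%:M -> drsubmx H \in unitmx ->
  form_part ((block_mx a 0 0 b)^T *m H *m block_mx a 0 0 b) =
  a^T *m form_part H *m a.
Proof.
move=> ab uD; have := metric_part_congr ab uD.
rewrite /form_part /metric_part => ->.
rewrite mulmxN mulNmx -{2}(submxK H) tr_block_mx !trmx0.
rewrite !mulmx_block !mulmx0 !mul0mx !addr0 !add0r block_mxKdl; congr (- _).
rewrite !mulmxA.
have ba := mulmx_tr_dual ab.
by rewrite -(mulmxA _ a b^T) ba mulmx1.
Qed.

(** The products H gamma H and gamma agree on S and on T, where H is gamma and
- gamma, because gamma squares to the identity. *)
Lemma compatible_involution H (S T : set 'cV[R]_(m + m)) :
  (forall v, exists u w, [/\ S u, T w & v = u + w]) ->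
  (forall u, S u -> H *m u = gamma *m u) ->
  (forall w, T w -> H *m w = - (gamma *m w)) ->
  H *m gamma *m H = gamma.
Proof.
move=> dec HS HT.
have gg : (gamma : 'M[R]_(m + m)) *m gamma = 1%:M.
  by rewrite mulmx_block !mulmx0 !mul0mx !mulmx1 !addr0 !add0r -scalar_mx_block.
suff e (v : 'cV[R]_(m + m)) : H *m gamma *m H *m v = gamma *m v.
  apply/matrixP => i j; have := e (delta_mx j ord0).
  by rewrite -!colE => /matrixP/(_ i ord0); rewrite !mxE.
have [u [w [Su Tw ->]]] := dec v.
rewrite -mulmxA mulmxDr HS // HT // -mulmxA mulmxBr !mulmxA gg !mul1mx.
by rewrite mulmxBr HS // HT // opprK -mulmxDr.
Qed.

(** A pseudo-orthonormal basis F of S satisfies H F = gamma F, whose lower half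
says that F lies on the graph of B + g.  Thus gamma restricted to S is 2 g in
the basis X of L-components of F, and sqrt(2) X is pseudo-orthonormal for g. *)
Lemma inertia_metric_part p q H (S : set 'cV[R]_(m + m)) :
  (p + q)%N = m -> H^T = H -> drsubmx H \in unitmx ->
  H *m gamma *m H = gamma ->
  (forall u, S u -> H *m u = gamma *m u) ->
  inertia_on gamma S p q -> inertia_on (metric_part H) setT p q.
Proof.
move=> hn sH uD HH HS [F [_ eS] Fg].
have HF : H *m F = gamma *m F.
  apply/matrixP => i j; have /HS : S (F *m delta_mx j ord0).
    by rewrite eS; exists (delta_mx j ord0).
  by rewrite !mulmxA -!colE => /matrixP/(_ i ord0); rewrite !mxE.
pose X := usubmx F; pose K := form_part H + metric_part H.
have eF : F = graph_frame K *m X.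
  rewrite -[LHS]vsubmxK graph_frameM; congr col_mx => //.
  move: HF; rewrite -{1}(submxK H) -(vsubmxK F) mul_block_col gamma_col.
  move=> /eq_col_mx[_]; rewrite -/X => e.
  have eD : drsubmx H *m dsubmx F = X - dlsubmx H *m X.
    by apply/eqP; rewrite eq_sym subr_eq addrC e.
  by rewrite col_mxKd -[LHS](mulKmx uD) eD mulmxBr mulmxDl mulNmx mulmxA addrC.
have eK : K^T + K = 2 *: metric_part H.
  rewrite {1}/K linearD /= metric_part_sym // form_part_antisym // addrACA addNr.
  by rewrite add0r -mulr2n -scaler_nat.
have sqrt2 : Num.sqrt (2 : R) * Num.sqrt 2 = 2 by rewrite -expr2 sqr_sqrtr.
apply/(inertia_setTP _ hn); exists (Num.sqrt 2 *: X).
rewrite trmxZ -!(scalemxAl, scalemxAr) scalerA sqrt2.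
move: Fg; rewrite eF trmx_mul !mulmxA -(mulmxA X^T) -(mulmxA X^T) graph_gamma.
by rewrite eK -scalemxAr -scalemxAl.
Qed.

End Block.
End PointwiseAlgebra.

(** * The correspondence for tensor fields *)

Section Correspondence.
Context {R : realType} {m p q : nat} {M : topologicalType}.
Variables (hpq : (p + q)%N = m) (A : bilagrangian R m M).
Implicit Types (gB : components A m * components A m) (H : components A (m + m)).

Definition gen_metric_of gB : components A (m + m) :=
  fun c x => gen_metric (gB.1 c x) (gB.2 c x).

Definition field_of H : components A m * components A m :=
  (fun c x => metric_part (H c x), fun c x => form_part (H c x)).

Lemma is_field_unit gB c x : is_field p q gB -> dom c x -> gB.1 c x \in unitmx.
Proof. by move=> [_ _ fgB] /fgB[_ /(inertia_unit hpq)]. Qed.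

Lemma form_on_LD (S T : components A m) :
  form_on_L S -> form_on_L T -> form_on_L (fun c x => S c x + T c x).
Proof.
move=> [sS eS] [sT eT]; split=> [c|c c' x a b cx c'x jac].
  have [[sSc S0] [sTc T0]] := (sS c, sT c); split.
    exact: smooth_mxD (@dom_open _ _ _ A c) (@subset_refl _ _) _ _ _ _ sSc sTc.
  by move=> x ncx; rewrite S0 ?T0 ?addr0.
by rewrite (eS c c' x a b) // (eT c c' x a b) // mulmxDr mulmxDl.
Qed.

Lemma form_on_LN (S : components A m) :
  form_on_L S -> form_on_L (fun c x => - S c x).
Proof.
move=> [sS eS]; split=> [c|c c' x a b cx c'x jac].
  have [sSc S0] := sS c; split.
    exact: smooth_mxN (@dom_open _ _ _ A c) (@subset_refl _ _) _ _ _ sSc.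
  by move=> x ncx; rewrite S0 ?oppr0.
by rewrite (eS c c' x a b) // mulmxN mulNmx.
Qed.

Lemma graph_subbundle (K : components A m) : form_on_L K ->
  subbundle m (fun c x => graph (K c x)).
Proof.
move=> [sK eK]; split=> [c c' x a b cx c'x jac|c x cx].
  by rewrite (eK c c' x a b) //; apply: graph_congr; case: jac.
exists (dom c), (fun y => graph_frame (K c y)); split=> //.
- exact: dom_open.
- have [sKc _] := sK c; apply: smooth_col_mx => //.
  exact: smooth_mx_cst.
- by move=> y _; exact: graph_basis.
Qed.

Lemma gen_metric_of_form gB : is_field p q gB -> form_on_TM (gen_metric_of gB).
Proof.
move=> fgB; have [[sg eg] [sB eB] _] := fgB.
split=> [c|c c' x a b cx c'x jac]; last first.
  have [ab _] := jac.
  rewrite /gen_metric_of (eg c c' x a b) // (eB c c' x a b) //.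
  exact: gen_metric_congr ab (is_field_unit fgB cx).
have [[sgc g0] [sBc B0]] := (sg c, sB c).
split=> [|x ncx]; last first.
  by rewrite /gen_metric_of g0 // B0 // gen_metric0.
have oc := @dom_open _ _ _ A c; have cc := @subset_refl _ (dom c).
have si : smooth_mx (c := c) (V := dom c) (fun y => invmx (gB.1 c y)).
  by apply: (smooth_invmx oc cc _ sgc) => y; exact: is_field_unit.
have sBi := smooth_mxM oc cc sBc si.
apply: smooth_block_mx => //.
- exact: (smooth_mxD oc cc sgc (smooth_mxN oc cc (smooth_mxM oc cc sBi sBc))).
- exact: (smooth_mxN oc cc (smooth_mxM oc cc si sBc)).
Qed.

Lemma gen_metric_of_generalized gB : is_field p q gB ->
  generalized_metric p q (gen_metric_of gB) /\
  nondegenerate_on_Lstar (gen_metric_of gB).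
Proof.
move=> fgB; have [Lg LB pt] := fgB; split; last first.
  move=> c x cx; apply/nondegenerate_on_LstarP.
  by rewrite block_mxKdr unitmx_inv is_field_unit.
split.
  split=> [|c x cx]; first exact: gen_metric_of_form.
  have [sg _ sB] := pt c x cx.
  split; first exact: gen_metric_sym.
  by apply: gen_metric_nondegenerate => //; exact: is_field_unit.
exists (fun c x => graph (gB.2 c x + gB.1 c x)).
exists (fun c x => graph (gB.2 c x - gB.1 c x)).
split; [exact/graph_subbundle/form_on_LD| |].
  exact/graph_subbundle/form_on_LD/form_on_LN.
move=> c x cx; have ug := is_field_unit fgB cx.
have [] := pt c x cx; rewrite /gen_metric_of.
move: (gB.1 c x) (gB.2 c x) ug => g B ug sg ig sB.
have [Hp Hm] := gen_metric_graph B ug.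
have eqp v w : graph (B + g) w -> bil (gen_metric g B) v w = bil gamma v w.
  by move=> [X _ <-]; rewrite /bil -!mulmxA (mulmxA _ _ X) Hp -!mulmxA.
have eqm v w : graph (B - g) w -> bil (gen_metric g B) v w = - bil gamma v w.
  move=> [X _ <-]; rewrite -bilN /bil -!mulmxA (mulmxA _ _ X) Hm.
  by rewrite !mulNmx -!mulmxA.
split; first by move=> v; exact: gen_metric_decomposition.
split.
  move=> v w Sv Sw; suff o : bil gamma v w = 0 by rewrite eqm // o oppr0.
  move: Sv Sw => [X _ <-] [Y _ <-].
  rewrite bil_mulmx graph_gamma [(_ + _)^T]linearD /= sg sB addrACA addNr subrr.
  by rewrite addr0 mulmx0 mul0mx mxE.
split; first by move=> v w _; exact: eqp.
split; first by move=> v w _; exact: eqm.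
split; apply: inertia_graph.
  rewrite linearD /= sg sB addrACA addNr add0r -mulr2n -scaler_nat.
  exact: inertia_scale.
rewrite linearB /= sg sB addrACA addNr add0r -mulr2n -scaler_nat scalerN.
apply: (inertia_opp hpq); exact: inertia_scale.
Qed.

(** The smoothness and tensoriality of the field come from those of H, as the
field is a rational function of H; the decomposition enters only pointwise,
through H gamma H = gamma and the inertia of S+. *)
Lemma field_of_is_field H : generalized_metric p q H ->
  nondegenerate_on_Lstar H -> is_field p q (field_of H) /\
  gen_metric_of (field_of H) = H.
Proof.
move=> [[[sH eH] metH] [Sp [Sm [_ _ pt]]]] nd.
have uD c x : dom c x -> drsubmx (H c x) \in unitmx.
  by move=> cx; apply/nondegenerate_on_LstarP/nd.
have HS c x : dom c x ->
    (forall u, Sp c x u -> H c x *m u = gamma *m u) /\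
    H c x *m gamma *m H c x = gamma.
  move=> cx; have [sHx _] := metH c x cx.
  have [dec [orth [eqp [eqm _]]]] := pt c x cx.
  have decP (v : 'cV[R]_(m + m)) :
      exists u w, [/\ Sp c x u, Sm c x w & v = u + w].
    by have [[u w] [uw _]] := dec v; exists u, w.
  have decM (v : 'cV[R]_(m + m)) :
      exists w u, [/\ Sm c x w, Sp c x u & v = w + u].
    by have [u [w [Su Sw ->]]] := decP v; exists w, u; rewrite addrC.
  have sg := @gamma_sym R m.
  have HP : forall u, Sp c x u -> H c x *m u = gamma *m u.
    apply: (bil_eq_on_summand sHx sg decP) => // v w Sv Sw.
    by have [] := orth v w Sv Sw.
  have HM w : Sm c x w -> H c x *m w = - (gamma *m w).
    rewrite -mulNmx; apply: (bil_eq_on_summand sHx _ decM).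
    - by rewrite linearN /= sg.
    - move=> v u Sv Su; have [ou oHu] := orth u v Su Sv.
      by rewrite bilN (bil_sym _ _ sHx) (bil_sym _ _ sg) ou oHu oppr0.
    - by move=> v u Sv Su; rewrite bilN eqm.
  by split=> //; exact: compatible_involution decP HP HM.
have H0 c x : ~ dom c x -> H c x = 0 by move=> ncx; have [_ ->] := sH c.
have g0 c x : ~ dom c x -> metric_part (H c x) = 0.
  by move=> ncx; rewrite H0 // metric_part0.
have B0 c x : ~ dom c x -> form_part (H c x) = 0.
  by move=> ncx; rewrite H0 // form_part0.
split; last first.
  apply/funext => c; apply/funext => x; rewrite /gen_metric_of /=.
  have [cx|ncx] := pselect (dom c x).
    have [sHx _] := metH c x cx; have [_ HH] := HS c x cx.
    by rewrite gen_metricK // uD.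
  by rewrite g0 // B0 // H0 // gen_metric0.
have oc c := @dom_open _ _ _ A c; have cc c := @subset_refl _ (@dom _ _ _ A c).
have sg c : smooth_mx (c := c) (V := dom c) (fun y => metric_part (H c y)).
  apply: (smooth_invmx (oc c) (cc c)) => [y|i j]; first exact: uD.
  have [sHc _] := sH c.
  apply: eq_smooth_in_chart (sHc (rshift m i) (rshift m j)) => y _.
  by rewrite !mxE.
have sB c : smooth_mx (c := c) (V := dom c) (fun y => form_part (H c y)).
  apply: (smooth_mxN (oc c) (cc c)); apply: (smooth_mxM (oc c) (cc c)) (sg c) _.
  move=> i j; have [sHc _] := sH c.
  apply: eq_smooth_in_chart (sHc (rshift m i) (lshift m j)) => y _.
  by rewrite !mxE.
split.
- split=> [c|c c' x a b cx c'x jac]; first by split=> [|x]; [exact: sg|exact: g0].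
  have [ab _] := jac.
  by rewrite /= (eH c c' x a b) // (metric_part_congr ab) // uD.
- split=> [c|c c' x a b cx c'x jac]; first by split=> [|x]; [exact: sB|exact: B0].
  have [ab _] := jac.
  by rewrite /= (eH c c' x a b) // (form_part_congr ab) // uD.
move=> c x cx; have [sHx _] := metH c x cx; have [HP HH] := HS c x cx.
have [_ [_ [_ [_ [ip _]]]]] := pt c x cx.
split; [exact: metric_part_sym| |exact: form_part_antisym (uD c x cx) HH].
exact: inertia_metric_part (uD c x cx) HH HP ip.
Qed.

End Correspondence.

Theorem proposition4p1 (R : realType) (m p q : nat) (hpq : (p + q)%N = m)
    (M : topologicalType) (A : bilagrangian R m M) :
  exists Phi : components A m * components A m -> components A (m + m),
    set_bij [set gB | is_field p q gB]
            [set H | generalized_metric p q H /\ nondegenerate_on_Lstar H]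
            Phi /\
    (forall gB gB', is_field p q gB -> is_field p q gB' ->
       forall c x, dom c x ->
         (gB.1 c x = gB'.1 c x /\ gB.2 c x = gB'.2 c x) <->
         Phi gB c x = Phi gB' c x).
Proof.
exists (@gen_metric_of R m M A).
have ptw (gB gB' : components A m * components A m) :
    is_field p q gB -> is_field p q gB' ->
    forall c x, dom c x ->
    (gB.1 c x = gB'.1 c x /\ gB.2 c x = gB'.2 c x) <->
    gen_metric_of gB c x = gen_metric_of gB' c x.
  move=> fgB _ c x cx; split=> [[eg eB]|]; first by rewrite /gen_metric_of eg eB.
  exact: gen_metric_inj (is_field_unit hpq fgB cx).
split=> //; split.
- by move=> gB; exact: gen_metric_of_generalized.
- move=> gB gB' /set_mem fgB /set_mem fgB' e.
  (* Outside the domain of a chart all components vanish. *)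
  have pw c x : gB.1 c x = gB'.1 c x /\ gB.2 c x = gB'.2 c x.
    have [cx|ncx] := pselect (dom c x); first by apply/ptw; rewrite ?e.
    have [[sg _] [sB _] _] := fgB; have [[sg' _] [sB' _] _] := fgB'.
    have [[_ ->] // [_ ->] //] := (sg c, sB c).
    by have [[_ ->] // [_ ->] //] := (sg' c, sB' c).
  rewrite (surjective_pairing gB) (surjective_pairing gB').
  by congr pair; apply/funext => c; apply/funext => x; have [] := pw c x.
move=> H [gH nd]; have [fH eH] := field_of_is_field hpq gH nd.
by exists (field_of H).
Qed.
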